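(* Let $d\ge 1$, let $\mathbf m=(m_1,\dots,m_d)\in\mathbb N^d$ and let $U\subseteq P(d,\mathbf m)$ be a color-squarefree monomial order ideal. Then for every $S\subseteq[d]$, $$h_S(\Delta_{\mathrm{bal}}(U))=\#\{u\in U : \mathrm{cSupp}(u)=S\}.$$
   Context: Here $\mathbb N$ contains $0$ and $[d]=\{1,\dots,d\}$. $P(d,\mathbf m)$ is the polynomial ring over a field $\mathbb K$ in variables $x_{i,j}$, $1\le i\le d$, $1\le j\le m_i$; $x_{i,j}$ has color $i$. A monomial is color-squarefree if it is squarefree and divisible by at most one variable of each color. A color-squarefree monomial order ideal is a set $U$ of color-squarefree monomials closed under taking divisors; throughout, it is assumed to contain $1$ and all variables of $P(d,\mathbf m)$. The color support of a monomial $u$ is $\mathrm{cSupp}(u)=\{i : x_{i,j}\text{ divides }u\text{ for some }j\}$. Balanced squeezed complex: let $V_i=\{1^{(i)},\dots,(m_i+1)^{(i)}\}$. For $u=x_{i_1,j_1}\cdots x_{i_s,j_s}$ color-squarefree with $i_1<\dots<i_s$ put $F_d(u)=\{j_1^{(i_1)},\dots,j_s^{(i_s)}\}\cup\{(m_j+1)^{(j)} : j\in[d]\setminus\{i_1,\dots,i_s\}\}$. Then $\Delta_{\mathrm{bal}}(U)$ is the simplicial complex whose facets are the sets $F_d(u)$, $u\in U$. It is colored by $\kappa(j^{(i)})=i$. For a balanced complex $\Delta$ with coloring $\kappa$ and $S\subseteq[d]$: $f_S(\Delta)=\#\{F\in\Delta:\kappa(F)=S\}$ (so $f_\emptyset(\Delta)=1$)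 and $h_S(\Delta)=\sum_{T\subseteq S}(-1)^{\#(S\setminus T)}f_T(\Delta)$. *)

(* Defs.v *)
From mathcomp Require Import all_boot all_algebra finmap.
From mathcomp Require Import monalg.

Set Implicit Arguments.
Unset Strict Implicit.
Unset Printing Implicit Defensive.

Import GRing.Theory.
Local Open Scope nat_scope.

(* Colors 1, .., d are the elements of 'I_d; a pair (i, j) with j < n i is the
   j-th object (counted from 0) of color i, and [tag] is its color. *)
Definition colored (d : nat) (n : 'I_d -> nat) : finType :=
  {i : 'I_d & 'I_(n i)}%type.

(* The variables x_{i,j} of P(d, m), and the vertices j^(i), 1 <= j <= m_i + 1. *)
Definition variable (d : nat) (m : 'I_d -> nat) : finType := colored m.
Definition vertex (d : nat) (m : 'I_d -> nat) : finType :=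
  colored (fun i => (m i).+1).

(* The monomials of P(d, m), as exponent functions; they do not involve the
   coefficient field. *)
Notation monomial m := {cmonom variable m}.

Section Monomials.
Variables (d : nat) (m : 'I_d -> nat).
Implicit Types (u v : monomial m) (x y : variable m) (U : {fset monomial m}).

Definition mdvd u v : bool := [forall x, u x <= v x].

Lemma mdvdP u v : reflect (exists w : monomial m, v = mmul u w) (mdvd u v).
Proof.
apply: (iffP forallP) => [le_uv|[w ->] x]; last by rewrite cmM leq_addr.
exists (divcm v u); apply/eqP/cmP => x.
by rewrite cmM divcmE addnC subnK.
Qed.

Definition var_mdvd x u : bool := mdvd (ucm x) u.

Definition color_squarefree u : bool :=
  [forall x, u x <= 1]
  && [forall x, forall y,
        [&& var_mdvd x u, var_mdvd y u & tag x == tag y] ==> (x == y)].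

Definition csupp u : {set 'I_d} :=
  [set i | [exists x, (tag x == i) && var_mdvd x u]].

(* There are finitely many color-squarefree monomials, so a finite set [U]
   loses no generality. *)
Definition color_squarefree_order_ideal U : Prop :=
  [/\ forall u, u \in U -> color_squarefree u,
      forall u v, u \in U -> mdvd v u -> v \in U,
      (mone : monomial m) \in U
    & forall x, ucm x \in U].

(* x_{i,j} |-> j^(i), and the extra vertex (m_i + 1)^(i). *)
Definition var_vertex x : vertex m :=
  Tagged (fun i => 'I_(m i).+1) (widen_ord (leqnSn _) (tagged x)).
Definition top_vertex (i : 'I_d) : vertex m :=
  Tagged (fun i => 'I_(m i).+1) (@ord_max (m i)).

Definition facet_of u : {set vertex m} :=
  [set var_vertex x | x : variable m & var_mdvd x u]
  :|: [set top_vertex i | i in ~: csupp u].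

End Monomials.

Section Complexes.
Variable T : finType.
Implicit Types (Delta Fs : {set {set T}}) (F G : {set T}).

(* A simplicial complex is given by its set of faces. *)
Definition simplicial_complex Delta : Prop :=
  forall F G, G \in Delta -> F \subset G -> F \in Delta.

Definition facets Delta : {set {set T}} :=
  [set F in Delta | [forall G in Delta, (F \subset G) ==> (F == G)]].

Definition generated_complex Fs : {set {set T}} :=
  [set F : {set T} | [exists G in Fs, F \subset G]].

Lemma generated_complexP Fs : simplicial_complex (generated_complex Fs).
Proof.
move=> F G; rewrite !inE => /exists_inP[H FsH sGH] sFG.
by apply/exists_inP; exists H => //; apply: subset_trans sGH.
Qed.

(* If no member of [Fs] is properly contained in another, then [Fs] is the set
   of facets of the complex that it generates. *)
Lemma facets_generated_complex Fs :
  (forall F G : {set T}, F \in Fs -> G \in Fs -> F \subset G -> F = G) ->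
  facets (generated_complex Fs) = Fs.
Proof.
move=> antichain; apply/setP => F; rewrite 2!inE.
apply/andP/idP => [[/exists_inP[G FsG sFG] /forall_inP maxF]|FsF].
  have GG: G \in generated_complex Fs.
    by rewrite inE; apply/exists_inP; exists G.
  by have /implyP/(_ sFG)/eqP-> := maxF G GG.
split; first by apply/exists_inP; exists F.
apply/forall_inP => G; rewrite inE => /exists_inP[H FsH sGH].
apply/implyP => sFG; rewrite eqEsubset sFG /=.
by rewrite (antichain F H FsF FsH (subset_trans sFG sGH)).
Qed.

Variables (d : nat) (kappa : T -> 'I_d).

Definition flag_f (Delta : {set {set T}}) (S : {set 'I_d}) : nat :=
  #|[set F in Delta | kappa @: F == S]|.

Definition flag_h (Delta : {set {set T}}) (S : {set 'I_d}) : int :=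
  (\sum_(R : {set 'I_d} | R \subset S)
     (-1) ^+ #|S :\: R| * (flag_f Delta R)%:Z)%R.

End Complexes.

Definition vertex_color (d : nat) (m : 'I_d -> nat) (v : vertex m) : 'I_d :=
  tag v.

Definition Delta_bal (d : nat) (m : 'I_d -> nat) (U : {fset monomial m}) :
    {set {set vertex m}} :=
  generated_complex [set F | has (fun u => F == facet_of u) U].

Section Balanced.
Variables (d : nat) (m : 'I_d -> nat).

Lemma mem_csupp (u : monomial m) (x : variable m) :
  var_mdvd x u -> tag x \in csupp u.
Proof. by move=> xu; rewrite inE; apply/existsP; exists x; rewrite eqxx. Qed.

(* Every F_d(u) contains exactly one vertex of each color. *)
Lemma facet_of_color (u : monomial m) (i : 'I_d) : color_squarefree u ->
  #|[set v in facet_of u | vertex_color v == i]| = 1.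
Proof.
case/andP=> _ /forallP uniq_u; apply/eqP/cards1P.
have [|iNu] := boolP (i \in csupp u).
  rewrite inE => /existsP[x /andP[/eqP <- xu]]; exists (var_vertex x).
  apply/setP => v; rewrite !inE; apply/andP/eqP => [[/orP[]]|->].
  - case/imsetP=> y; rewrite inE => yu -> /= eq_yx; congr var_vertex.
    have /forallP/(_ x)/implyP := uniq_u y.
    by rewrite yu xu; move=> /(_ eq_yx)/eqP.
  - case/imsetP=> j; rewrite inE => jNu -> /= /eqP ji.
    by move: jNu; rewrite /vertex_color /= in ji; rewrite ji mem_csupp.
  split; last exact: eqxx.
  by apply/orP; left; apply/imsetP; exists x; rewrite ?inE.
exists (top_vertex m i); apply/setP => v; rewrite !inE.
apply/andP/eqP => [[/orP[]]|->].
- case/imsetP=> y; rewrite inE => yu -> /= /eqP yi.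
  by move: iNu; rewrite -yi /vertex_color /= mem_csupp.
- by case/imsetP=> j _ -> /= /eqP <-.
split; last exact: eqxx.
by apply/orP; right; apply: imset_f; rewrite in_setC.
Qed.

Lemma facets_Delta_bal (U : {fset monomial m}) :
  (forall u, u \in U -> color_squarefree u) ->
  facets (Delta_bal U) = [set F | has (fun u => F == facet_of u) U].
Proof.
move=> Usf; apply: facets_generated_complex => F G; rewrite !inE.
case/hasP=> u Uu /eqP-> /hasP[w Uw /eqP->] sFG.
apply/eqP; rewrite eqEsubset sFG /=; apply/subsetP => v wv.
have /eqP/cards1P[a Da] := facet_of_color (vertex_color v) (Usf u Uu).
have /eqP/cards1P[b Db] := facet_of_color (vertex_color v) (Usf w Uw).
have: v \in [set b] by rewrite -Db inE wv eqxx.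
have: a \in [set a] by rewrite inE.
rewrite -{1}Da inE => /andP[ua ca]; have: a \in [set b].
  by rewrite -Db inE (subsetP sFG) //.
by move=> /set1P<- /set1P->.
Qed.

End Balanced.

(* Main.v *)
Require Import Defs.
From mathcomp Require Import all_boot all_algebra finmap.
From mathcomp Require Import monalg.

Set Implicit Arguments.
Unset Strict Implicit.
Unset Printing Implicit Defensive.

Import GRing.Theory.
Local Open Scope nat_scope.

(** A facet [facet_of u] has exactly one vertex of each color, so a face with
    color set [R] is a facet cut down to the colors in [R].  The cut forgets the
    variables of [u] whose color is not in [R], and the order ideal is closed
    under divisors, so [u] may be replaced by its part [color_restrict R u]
    with colors in [R].  From then on [u] can be recovered from the face: its
    variables are the vertices of the face other than the top ones.  Hence
    the faces with color set [R] correspond to the monomials of [U] with color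
    support inside [R] ([flag_f_Delta_bal]), that is,
    [f_R = \sum_(A \subset R) #{u in U : csupp u = A}].
    The number [h_S] is by definition the Moebius inversion of [f] over the
    subsets of [S] ([moebius_inversion_subset]), which gives back the summand
    for [A = S]. *)

(** * Moebius inversion over subsets *)

(** For [A] properly contained in [S], adding and removing one fixed
    element of [S :\: A] pairs off the sets of the interval with opposite
    signs. *)
Lemma sum_sign_interval (I : finType) (A S : {set I}) :
  (\sum_(R : {set I} | (A \subset R) && (R \subset S)) (-1) ^+ #|S :\: R|
   = (A == S)%:R :> int)%R.
Proof.
have [<-|neqAS] := eqVneq A S.
  rewrite (big_pred1 A) => [|R]; first by rewrite setDv cards0 expr0.
  by rewrite /= eqEsubset andbC.
have [sAS|nsAS] := boolP (A \subset S); last first.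
  rewrite big_pred0 // => R; apply: contraNF nsAS.
  by case/andP; apply: subset_trans.
have /properP[_ [x xS xNA]] : A \proper S by rewrite properEneq neqAS.
(* The sets containing x are rewritten as x |: R with x outside R. *)
rewrite (bigID (fun R : {set I} => x \in R)) /=.
rewrite (reindex_onto (fun R => x |: R) (fun R => R :\ x)) /=; last first.
  by move=> R /andP[_ xR]; rewrite setD1K.
rewrite [X in (X + _)%R](eq_bigl (fun R : {set I} =>
    ((A \subset R) && (R \subset S)) && (x \notin R))); last first.
  move=> R; rewrite setU11 andbT subUset sub1set xS /=.
  have -> : (x |: R) :\ x == R = (x \notin R).
    apply/eqP/idP => [<-|xNR]; first by rewrite setD11.
    by rewrite setU1K.
  have [xR|xNR] := boolP (x \in R); first by rewrite !andbF.
  rewrite !andbT; congr (_ && _); apply/subsetP/subsetP => sAR y yA.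
    by have /setU1P[yx|//] := sAR y yA; rewrite yx (negPf xNA) in yA.
  by rewrite inE sAR ?orbT.
rewrite -big_split big1 //= => R /andP[_ xNR].
rewrite (cardsD1 x (S :\: R)) !inE xNR xS exprS mulN1r.
suff -> : S :\: (x |: R) = (S :\: R) :\ x by rewrite addrN.
by rewrite setDDl setUC.
Qed.

Lemma moebius_inversion_subset (I : finType) (g : {set I} -> int)
    (S : {set I}) :
  (\sum_(R : {set I} | R \subset S)
     (-1) ^+ #|S :\: R| * \sum_(A : {set I} | A \subset R) g A = g S)%R.
Proof.
under eq_bigr => R _ do rewrite mulr_sumr.
rewrite (exchange_big_dep xpredT) //=.
under eq_bigr => A _.
  rewrite -mulr_suml (eq_bigl (fun R : {set I} =>
    (A \subset R) && (R \subset S))); last by move=> R; rewrite andbC.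
  rewrite sum_sign_interval; over.
rewrite (bigD1 S) //= eqxx mul1r big1 ?addr0 // => A /negPf->.
by rewrite mul0r.
Qed.

(** * Monomials and their restriction to a set of colors *)

Section BalancedSqueezed.
Variables (d : nat) (m : 'I_d -> nat).
Implicit Types (u v : monomial m) (x : variable m) (R S : {set 'I_d}).

Lemma var_mdvdE x u : var_mdvd x u = (0 < u x).
Proof.
apply/forallP/idP => [/(_ x)|ux y]; first by rewrite ucmE eqxx.
by rewrite ucmE; case: eqP => // <-.
Qed.

Lemma squarefree_eq u v :
  color_squarefree u -> color_squarefree v ->
  (forall x, var_mdvd x u = var_mdvd x v) -> u = v.
Proof.
case/andP=> /forallP u1 _ /andP[/forallP v1 _] uv; apply/eqP/cmP => x.
have := uv x; rewrite !var_mdvdE; have := u1 x; have := v1 x.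
by case: (u x) => [|[|?]]; case: (v x) => [|[|?]].
Qed.

Definition color_restrict R u : monomial m :=
  [cmonom if tag x \in R then u x else 0 | x in finsupp u]%M.

Lemma color_restrictE R u x :
  color_restrict R u x = if tag x \in R then u x else 0.
Proof.
rewrite /color_restrict cmE /= fsfunE.
by case: finsuppP => //; rewrite if_same.
Qed.

Lemma var_mdvd_restrict R u x :
  var_mdvd x (color_restrict R u) = (tag x \in R) && var_mdvd x u.
Proof. by rewrite !var_mdvdE color_restrictE; case: ifP. Qed.

Lemma mdvd_restrict R u : mdvd (color_restrict R u) u.
Proof. by apply/forallP => x; rewrite color_restrictE; case: ifP. Qed.

Lemma csupp_restrict R u : csupp (color_restrict R u) = csupp u :&: R.
Proof.
apply/setP => i; rewrite !inE; apply/existsP/andP.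
  case=> x; rewrite var_mdvd_restrict => /and3P[/eqP<- xR xu].
  by split=> //; apply/existsP; exists x; rewrite eqxx.
case=> /existsP[x /andP[/eqP<- xu]] xR; exists x.
by rewrite eqxx var_mdvd_restrict xR.
Qed.

(** * Faces of the balanced squeezed complex *)

Definition face_of R u : {set vertex m} :=
  [set v in facet_of u | vertex_color v \in R].

Lemma in_face_of R u (v : vertex m) :
  (v \in face_of R u) = (v \in facet_of u) && (vertex_color v \in R).
Proof. by rewrite inE. Qed.

Lemma var_vertex_inj : injective (@var_vertex d m).
Proof.
move=> [i j] [i' j'] /eqP; rewrite -tag_eqE /tag_eq /= => /andP[/eqP eqi].
case: i' / eqi j' => j'; rewrite tagged_asE => /eqP/(congr1 val)/= jj'.
by congr (existT _ _ _); apply: val_inj.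
Qed.

Lemma var_vertex_neq_top x i : var_vertex x != top_vertex m i.
Proof.
case: x => i' j; apply/negP; rewrite -tag_eqE /tag_eq /= => /andP[/eqP eqi].
case: i / eqi; rewrite tagged_asE => /eqP/(congr1 val)/= jm.
by have := ltn_ord j; rewrite jm ltnn.
Qed.

Lemma var_vertex_facet x u : (var_vertex x \in facet_of u) = var_mdvd x u.
Proof.
rewrite inE; apply/orP/idP => [[]|xu].
- by case/imsetP=> y; rewrite inE => yu /var_vertex_inj ->.
- by case/imsetP=> i _ xi; have := var_vertex_neq_top x i; rewrite xi eqxx.
by left; apply: imset_f; rewrite inE.
Qed.

Lemma top_vertex_facet i u :
  (top_vertex m i \in facet_of u) = (i \notin csupp u).
Proof.
rewrite in_setU; apply/orP/idP => [[]|iu].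
- by case/imsetP=> x _ xi; have := var_vertex_neq_top x i; rewrite -xi eqxx.
- by case/imsetP=> j; rewrite in_setC => ju [->].
by right; apply: imset_f; rewrite in_setC.
Qed.

Lemma vertex_cases (v : vertex m) :
  (exists x, v = var_vertex x) \/ v = top_vertex m (tag v).
Proof.
case: v => i j; have [jm|mj] := ltnP j (m i); [left|right].
  exists (Tagged (fun i => 'I_(m i)) (Ordinal jm)).
  by congr (existT _ _ _); apply: val_inj.
congr (existT _ _ _); apply: val_inj; apply/eqP.
by rewrite eqn_leq mj -ltnS ltn_ord.
Qed.

(** Dropping the variables of the colors outside [R] changes the facet only in
    these colors, where the dropped variable gives way to the top vertex. *)
Lemma face_of_restrict R u : face_of R (color_restrict R u) = face_of R u.
Proof.
apply/setP => v; rewrite !in_face_of.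
have [vR|//] := boolP (vertex_color v \in R); last by rewrite !andbF.
rewrite !andbT; case: (vertex_cases v) vR => [[x ->]|->] /= vR.
  by rewrite !var_vertex_facet var_mdvd_restrict [tag x \in R]vR.
by rewrite !top_vertex_facet csupp_restrict in_setI [tag v \in R]vR andbT.
Qed.

Lemma face_of_colors R u :
  color_squarefree u -> @vertex_color d m @: face_of R u = R.
Proof.
move=> usf; apply/setP => i; apply/imsetP/idP => [[v]|iR].
  by rewrite in_face_of => /andP[_ vR] ->.
have /eqP/cards1P[v /setP/(_ v)] := facet_of_color i usf.
rewrite set11 inE => /andP[vu /eqP vi].
by exists v; rewrite // in_face_of vu vi.
Qed.

(** A facet has a single vertex of each color, so a vertex of [facet_of u] that
    shares its color with a vertex of [F] is that vertex. *)
Lemma subface_facet u (F : {set vertex m}) :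
  color_squarefree u -> F \subset facet_of u ->
  F = face_of (@vertex_color d m @: F) u.
Proof.
move=> usf sFu; apply/eqP; rewrite eqEsubset; apply/andP; split.
  by apply/subsetP => v vF; rewrite in_face_of (subsetP sFu) ?imset_f.
apply/subsetP => v; rewrite in_face_of => /andP[vu /imsetP[w wF vw]].
have /eqP/cards1P[a /setP Da] := facet_of_color (vertex_color v) usf.
have := Da v; rewrite in_set1 in_set vu eqxx => /esym/eqP ->.
have := Da w; rewrite in_set1 in_set (subsetP sFu) //.
by rewrite vw eqxx => /esym/eqP <-.
Qed.

(** The face shows only the variables with color in [R]; the support hypotheses
    make these all the variables of the two monomials. *)
Lemma face_of_inj R u v :
  color_squarefree u -> color_squarefree v ->
  csupp u \subset R -> csupp v \subset R -> face_of R u = face_of R v -> u = v.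
Proof.
move=> usf vsf suR svR eqF; apply: squarefree_eq => // x.
have xR w : csupp w \subset R ->
    var_mdvd x w = (var_vertex x \in face_of R w).
  move=> swR; rewrite in_face_of var_vertex_facet.
  by have [/mem_csupp/(subsetP swR)->|] := boolP (var_mdvd x w).
by rewrite !xR // eqF.
Qed.

(** The map [face_of R] is the bijection behind the count; a preimage of a face
    of [facet_of u] is [color_restrict R u], which is in [U] as a divisor
    of [u]. *)
Lemma flag_f_Delta_bal (U : {fset monomial m}) R :
  color_squarefree_order_ideal U ->
  flag_f (@vertex_color d m) (Delta_bal U) R
  = count (fun u => csupp u \subset R) U.
Proof.
case=> Usf Udvd _ _; rewrite -size_filter -(size_map (face_of R)).
have /card_uniqP <- :
    uniq [seq face_of R u | u <- U & csupp u \subset R].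
  rewrite map_inj_in_uniq ?filter_uniq ?fset_uniq // => u v.
  rewrite !mem_filter => /andP[su Uu] /andP[sv Uv].
  by apply: face_of_inj; rewrite ?Usf.
apply: eq_card => F; rewrite !inE; apply/andP/mapP.
  case=> /exists_inP[G]; rewrite inE => /hasP[u Uu /eqP->] sFu /eqP FR.
  exists (color_restrict R u).
    rewrite mem_filter csupp_restrict subsetIr.
    exact: Udvd Uu (mdvd_restrict R u).
  by rewrite face_of_restrict {1}(subface_facet (Usf u Uu) sFu) FR.
case=> u; rewrite mem_filter => /andP[suR Uu] ->.
split; last by rewrite face_of_colors ?Usf.
apply/exists_inP; exists (facet_of u).
  by rewrite inE; apply/hasP; exists u.
by apply/subsetP => v; rewrite in_face_of => /andP[].
Qed.

End BalancedSqueezed.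

(** * The flag h-numbers *)

Theorem corollary3p10 (d : nat) (m : 'I_d -> nat) (U : {fset monomial m})
    (hd : (0 < d)%N) (hU : color_squarefree_order_ideal U) :
  forall S : {set 'I_d},
    flag_h (@vertex_color d m) (Delta_bal U) S
    = (#|` [fset u in U | csupp u == S]%fset |%:Z)%R.
Proof.
move=> S.
have -> : #|` [fset u in U | csupp u == S]%fset|
          = count (fun u => csupp u == S) U.
  rewrite -size_filter; apply/perm_size/uniq_perm.
  - exact: fset_uniq.
  - exact/filter_uniq/fset_uniq.
  by move=> u; rewrite mem_filter !inE andbC.
rewrite -[RHS](moebius_inversion_subset
  (fun A => Posz (count (fun u : monomial m => csupp u == A) U))).
apply: eq_bigr => R _; congr (_ * _)%R.
rewrite flag_f_Delta_bal // -(big_morph Posz PoszD (erefl _)); congr Posz.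
(* Each monomial with support inside R is counted once, for A = csupp u. *)
elim: (enum_fset U) => [|u s IHs] /=; first by rewrite big1.
rewrite big_split /= -IHs; congr (_ + _).
have [suR|nsuR] := boolP (csupp u \subset R).
  rewrite (bigD1 (csupp u)) //= eqxx big1 // => A /andP[_ /negPf].
  by rewrite eq_sym => ->.
by rewrite big1 // => A sAR; case: eqP nsuR => // ->; rewrite sAR.
Qed.
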